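(* Let $p\ge 2$ be an integer, $0\le t\le 1$ and $u>0$, and let $D=\mathrm{DASEP}(3,p,2)$ with stationary distribution $\mathrm{Pd}$. Then the following are equivalent: (i) $t=1$; (ii) for every partition $\lambda=(\lambda_1\ge\lambda_2\ge\lambda_3\ge0)$ with $\lambda_1\le p$ and exactly $2$ nonzero parts, and all $\mu,\nu\in S_3(\lambda)$, $$\frac{\Pr_\lambda(\mu)}{\Pr_\lambda(\nu)}=\frac{\mathrm{Pd}(\mu)}{\mathrm{Pd}(\nu)}.$$
   Context: For a partition $\lambda=(\lambda_1\ge\dots\ge\lambda_n\ge 0)$ of nonnegative integers, $S_n(\lambda)$ denotes the set of all distinct rearrangements of $\lambda$, viewed as words $(\mu_1,\dots,\mu_n)$ whose positions $1,\dots,n$ lie on a circle. Fix $0\le t\le 1$. ASEP($\lambda$) is the Markov chain on $S_n(\lambda)$ with transition probabilities $P_{\mu,\nu}$ defined as follows. If $\mu$ has entries $i\ne j$ in adjacent positions $k,k+1$ ($1\le k\le n-1$) and $\nu$ is obtained from $\mu$ by swapping them, then $P_{\mu,\nu}=t/n$ if $i>j$ and $P_{\mu,\nu}=1/n$ if $i<j$. If $\mu=(i,\mu_2,\dots,\mu_{n-1},j)$ with $i\ne j$ and $\nu=(j,\mu_2,\dots,\mu_{n-1},i)$, then $P_{\mu,\nu}=t/n$ if $j>i$ and $P_{\mu,\nu}=1/n$ if $i>j$. All other off-diagonal transition probabilities are $0$, and the diagonal entries are chosen so that each row sums to $1$. $\Pr_\lambda$ denotes the stationary distribution of ASEP($\lambda$).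 Fix also $u>0$. For positive integers $n,p,q$ with $n>q$, DASEP$(n,p,q)$ is the Markov chain on the set of words in $\{0,1,\dots,p\}^n$ with exactly $q$ nonzero entries (equivalently, the union of $S_n(\lambda)$ over partitions $\lambda$ with $\lambda_1\le p$ and exactly $q$ nonzero parts). Its transition probabilities are as follows. The two swap rules of ASEP apply, with probabilities $t/(3n)$ and $1/(3n)$ in place of $t/n$ and $1/n$. Replacing a single entry $i$ with $1\le i\le p-1$ by $i+1$ has probability $u/(3n)$. Replacing a single entry $i+1$ with $i\ge 1$ by $i$ has probability $1/(3n)$. All other off-diagonal transition probabilities are $0$, and the diagonal entries make each row sum to $1$. $\mathrm{Pd}$ denotes the stationary distribution of the DASEP. *)

(* Defs.v *)
From mathcomp Require Import all_boot all_order all_algebra.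
Set Implicit Arguments. Unset Strict Implicit. Unset Printing Implicit Defensive.
Import Order.TTheory GRing.Theory Num.Theory.
Local Open Scope ring_scope.

(* Words of length n with letters in {0,..,m-1}; positions 0..n-1 stand for
   the paper's positions 1..n on a circle. *)
Notation word n m := ({ffun 'I_n -> 'I_m}) (only parsing).

Section Chains.
Variables (R : realFieldType) (n m : nat).
Local Notation W := (word n m).

Definition swapw (w : W) (a b : 'I_n) : W :=
  [ffun i => if i == a then w b else if i == b then w a else w i].

Definition adjpos (a b : 'I_n) : bool := val b == (val a).+1.
Definition wrappos (a b : 'I_n) : bool := (val a == 0%N) && (val b == n.-1).

Definition swap_off (s t : R) (mu nu : W) : R :=
  if [exists a, exists b, [&& adjpos a b, (val (mu b) < val (mu a))%N & nu == swapw mu a b]]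
  then t * s
  else if [exists a, exists b, [&& adjpos a b, (val (mu a) < val (mu b))%N & nu == swapw mu a b]]
  then s
  else if [exists a, exists b, [&& wrappos a b, (val (mu a) < val (mu b))%N & nu == swapw mu a b]]
  then t * s
  else if [exists a, exists b, [&& wrappos a b, (val (mu b) < val (mu a))%N & nu == swapw mu a b]]
  then s
  else 0.

Definition asep_off (t : R) (mu nu : W) : R :=
  if mu == nu then 0 else swap_off (n%:R)^-1 t mu nu.

(* off-diagonal transition probabilities of DASEP(n,p,q) (here m = p+1) *)
Definition dasep_off (t u : R) (mu nu : W) : R :=
  if mu == nu then 0 else
  swap_off (3 * n%:R)^-1 t mu nu
  + (if [exists k, [&& (1 <= val (mu k))%N, val (nu k) == (val (mu k)).+1
                     & [forall j, (j != k) ==> (nu j == mu j)]]]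
     then u / (3 * n%:R) else 0)
  + (if [exists k, [&& (1 <= val (nu k))%N, val (mu k) == (val (nu k)).+1
                     & [forall j, (j != k) ==> (nu j == mu j)]]]
     then (3 * n%:R)^-1 else 0).

Definition trans (S : pred W) (off : W -> W -> R) (mu nu : W) : R :=
  if mu == nu then 1 - \sum_(w in S | w != mu) off mu w else off mu nu.

Definition stationary (S : pred W) (off : W -> W -> R) (pi : W -> R) : Prop :=
  [/\ forall w, 0 <= pi w,
      forall w, w \notin S -> pi w = 0,
      \sum_(w in S) pi w = 1
    & forall nu, nu \in S -> pi nu = \sum_(mu in S) pi mu * trans S off mu nu].

End Chains.

Definition rearr n m (lam : word n m) : pred (word n m) :=
  [pred w : word n m | perm_eq (codom w) (codom lam)].

Definition nnz n m (w : word n m) : nat := #|[pred i | val (w i) != 0%N]|.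

Definition is_partition n m (lam : word n m) : bool :=
  [forall i : 'I_n, forall j : 'I_n, (val i <= val j)%N ==> (val (lam j) <= val (lam i))%N].

(* state set of DASEP(n,p,q) with m = p+1 *)
Definition dasep_states n m (q : nat) : pred (word n m) := [pred w : word n m | nnz w == q].
Arguments dasep_states : clear implicits.

(* Main.v *)
Require Import Defs.
From mathcomp Require Import all_boot all_order all_algebra perm fingroup.
From mathcomp Require Import ring lra zify.
Set Implicit Arguments.
Unset Strict Implicit.
Unset Printing Implicit Defensive.
Import Order.TTheory GRing.Theory Num.Theory.
Local Open Scope ring_scope.

(** If a chain is reversible with respect to a positive weight, the Dirichlet form shows that
    every solution of its balance equations is a constant multiple of the weight along each
    transition.  The letter updates of the DASEP are always reversible with respect to
    u ^ (sum of the letters), and the swaps preserve this weight and are symmetric when t = 1.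
    Hence for t = 1 both stationary measures are constant on rearrangement classes and all
    ratios are 1.

    Conversely, if the ratios agree, Pd is proportional to the ASEP measure on each class, so the
    swaps cancel in its balance equations and the updates alone are balanced.  Comparing with the
    words 011, 101, 110 gives Pd(012) = Pd(021), Pd(201) = Pd(102) and Pd(120) = Pd(210), and the
    same equalities for Pr.  But the flow of ASEP(2,1,0) between the two cyclic orders forces
    (2 + t) (Pr(012) + Pr(120) + Pr(201)) = (1 + 2 t) (Pr(021) + Pr(102) + Pr(210)), so t = 1. *)

Section ReversibleChains.
Variable R : realFieldType.

Lemma dirichlet_form_eq0 (T : finType) (S : pred T) (c : T -> T -> R) (f : T -> R) :
  (forall x y, 0 <= c x y) -> (forall x y, x \in S -> y \in S -> c x y = c y x) ->
  (forall y, y \in S -> \sum_(x in S) c x y * (f x - f y) = 0) ->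
  forall x y, x \in S -> y \in S -> c x y != 0 -> f x = f y.
Proof.
move=> c_ge0 c_sym bal.
have E1 : \sum_(y in S) \sum_(x in S) c x y * (f x - f y) * f y = 0.
  by rewrite big1 // => y Sy; rewrite -mulr_suml bal // mul0r.
have E2 : \sum_(y in S) \sum_(x in S) c x y * (f x - f y) * f x = 0.
  rewrite exchange_big big1 // => y Sy.
  rewrite -mulr_suml (eq_bigr (fun x => - (c x y * (f x - f y)))).
    by rewrite sumrN bal // oppr0 mul0r.
  by move=> x Sx; rewrite c_sym //; ring.
have E : \sum_(y in S) \sum_(x in S) c x y * (f x - f y) ^+ 2 = 0.
  rewrite -[RHS](subr0 0) -[in X in X - _]E2 -[in X in _ - X]E1 -sumrB.
  apply: eq_bigr => y _.
  by rewrite -sumrB; apply: eq_bigr => x _; ring.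
have term_ge0 x y : 0 <= c x y * (f x - f y) ^+ 2 by rewrite mulr_ge0 ?sqr_ge0.
move=> x y Sx Sy cxy.
have /eqP := E; rewrite psumr_eq0; last by move=> z _; apply: sumr_ge0.
move/allP/(_ y); rewrite mem_index_enum Sy => /(_ isT) /=.
rewrite psumr_eq0; last by move=> z _.
move/allP/(_ x); rewrite mem_index_enum Sx => /(_ isT) /=.
by rewrite mulf_eq0 (negPf cxy) sqrf_eq0 subr_eq0 => /eqP.
Qed.

Lemma reversible_balance_eq (T : finType) (S : pred T) (m : T -> R)
    (off : T -> T -> R) (pi : T -> R) :
  (forall x, 0 < m x) -> (forall x y, 0 <= off x y) ->
  (forall x y, x \in S -> y \in S -> m x * off x y = m y * off y x) ->
  (forall y, y \in S -> \sum_(x in S) (pi x * off x y - pi y * off y x) = 0) ->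
  forall x y, x \in S -> y \in S -> off x y != 0 -> pi x / m x = pi y / m y.
Proof.
move=> m_gt0 off_ge0 db bal x y Sx Sy offxy.
apply: (@dirichlet_form_eq0 T S (fun x y => m x * off x y) (fun x => pi x / m x)) => //.
- by move=> a b; rewrite mulr_ge0 // ltW.
- move=> b Sb; rewrite -[RHS](bal b Sb); apply: eq_bigr => a Sa.
  have ma := lt0r_neq0 (m_gt0 a); have mb := lt0r_neq0 (m_gt0 b).
  by rewrite mulrBr {2}db //; field; apply/andP.
- by rewrite mulf_neq0 // lt0r_neq0.
Qed.

Lemma stationary_balance (n m : nat) (S : pred (word n m)) off (pi : word n m -> R) nu :
  stationary S off pi -> (forall w, off w w = 0) -> nu \in S ->
  \sum_(mu in S) (pi mu * off mu nu - pi nu * off nu mu) = 0.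
Proof.
case=> _ _ _ st off0 Snu.
rewrite (bigD1 nu) //= subrr add0r sumrB -mulr_sumr.
move: (st nu Snu); rewrite (bigD1 nu) //= /trans eqxx.
under eq_bigr => i /andP[_ /negPf ->] do [].
lra.
Qed.

End ReversibleChains.

Section Moves.
Variables (R : realFieldType) (n m : nat).
Implicit Types (mu nu w : word n m) (s t u : R).

Definition raises mu nu : bool :=
  [exists k, [&& (1 <= val (mu k))%N, val (nu k) == (val (mu k)).+1
                     & [forall j, (j != k) ==> (nu j == mu j)]]].

Definition update_rate u mu nu : R := u * (raises mu nu)%:R + (raises nu mu)%:R.

Definition weight u w : R := u ^+ (\sum_i val (w i)).

Lemma raises_irr w : raises w w = false.
Proof. by apply/existsP => -[k /and3P[_]]; rewrite eqn_leq ltnn andbF. Qed.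

Lemma raises_weight u mu nu : raises mu nu -> weight u nu = u * weight u mu.
Proof.
case/existsP => k /and3P[_ /eqP nuk /forallP nuj].
rewrite /weight (bigD1 k) // [in RHS](bigD1 k) //= nuk addSn exprS.
congr (_ * (_ ^+ (_ + _))); apply: eq_bigr => j jk.
by move: (nuj j); rewrite jk => /eqP ->.
Qed.

Lemma weight_gt0 u w : 0 < u -> 0 < weight u w.
Proof. exact: exprn_gt0. Qed.

Lemma update_rate_ge0 u mu nu : 0 < u -> 0 <= update_rate u mu nu.
Proof. by move=> u0; rewrite addr_ge0 ?mulr_ge0 ?ler0n // ltW. Qed.

Lemma update_rate_neq0 u mu nu : 0 < u -> raises mu nu -> update_rate u mu nu != 0.
Proof. by move=> u0 h; rewrite lt0r_neq0 // /update_rate h mulr1 ltr_pwDl ?ler0n. Qed.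

Lemma update_rate_reversible u mu nu :
  weight u mu * update_rate u mu nu = weight u nu * update_rate u nu mu.
Proof.
have up := @raises_weight u mu nu; have down := @raises_weight u nu mu.
rewrite /update_rate; case: (raises mu nu) up => [/(_ isT) up|_].
  case: (raises nu mu) down => [/(_ isT) down|_] /=; last by rewrite up; ring.
  by rewrite !mulr1 !mulrDr !mulr1 ![_ * u]mulrC -up -down addrC.
by case: (raises nu mu) down => [/(_ isT) ->|_] /=; ring.
Qed.

Lemma swapw_tperm mu a b : swapw mu a b = [ffun i => mu (tperm a b i)].
Proof.
apply/ffunP => i; rewrite !ffunE; case: tpermP => [->|->|]; rewrite ?eqxx //.
  by case: eqP => // ->.
by do 2![move/eqP/negPf->].
Qed.

Lemma swapwC mu a b : swapw mu a b = swapw mu b a.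
Proof. by rewrite !swapw_tperm tpermC. Qed.

Lemma swapwK mu a b : swapw (swapw mu a b) a b = mu.
Proof. by rewrite !swapw_tperm; apply/ffunP => i; rewrite !ffunE tpermK. Qed.

Lemma codom_perm mu (s : 'S_n) : perm_eq (codom [ffun i => mu (s i)]) (codom mu).
Proof.
have -> : codom [ffun i => mu (s i)] = map mu (map s (enum 'I_n)).
  by rewrite -map_comp /codom /image_mem; apply: eq_map => i; rewrite /= ffunE.
apply: perm_map; apply: uniq_perm (enum_uniq _) _.
  by rewrite (map_inj_uniq perm_inj) enum_uniq.
by move=> i; rewrite mem_enum -[i](permKV s) map_f // mem_enum.
Qed.

Lemma codom_swapw mu a b : perm_eq (codom (swapw mu a b)) (codom mu).
Proof. by rewrite swapw_tperm codom_perm. Qed.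

Lemma perm_codom_invariant (A : Type) (F : word n m -> A) mu nu :
  (forall w a b, perm_eq (codom w) (codom mu) -> F (swapw w a b) = F w) ->
  perm_eq (codom nu) (codom mu) -> F nu = F mu.
Proof.
move=> FE perm_nm.
have [s Es] : exists s : 'S_n, nu = [ffun i => mu (s i)].
  have szc w : size (codom w) == n by rewrite size_codom card_ord.
  have /tuple_permP[s Es] : perm_eq (codom nu) (Tuple (szc mu)) by [].
  exists s; apply/ffunP => i; rewrite ffunE.
  have := congr1 (nth (mu i) ^~ i) Es.
  rewrite (nth_map i) ?size_enum_ord // nth_ord_enum => ->.
  rewrite (nth_map i) ?size_enum_ord // nth_ord_enum (tnth_nth (mu i)) /=.
  by rewrite (nth_map i) ?size_enum_ord // nth_ord_enum.
rewrite Es; have [ts -> _] := prod_tpermP s.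
elim: ts => [|[a b] ts IH] /=.
  by congr F; apply/ffunP => i; rewrite big_nil ffunE perm1.
rewrite -IH big_cons /=.
set r := (\prod_(_ <- ts) _)%g.
rewrite -(FE [ffun i => mu (r i)] a b) ?codom_perm // swapw_tperm.
by congr F; apply/ffunP => i; rewrite !ffunE permM.
Qed.

Lemma weight_perm u mu nu : perm_eq (codom nu) (codom mu) -> weight u nu = weight u mu.
Proof.
move=> h; rewrite /weight; congr (_ ^+ _).
have E w : (\sum_i val (w i) = \sum_(x <- codom w) val x)%N.
  by rewrite /codom /image_mem big_map big_enum.
by rewrite !E; apply: perm_big.
Qed.

Lemma nnz_perm mu nu : perm_eq (codom nu) (codom mu) -> nnz nu = nnz mu.
Proof.
have E w : nnz w = count (fun x : 'I_m => val x != 0%N) (codom w).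
  rewrite /nnz -sum1_card -sum1_count /codom /image_mem big_map big_enum_cond.
  exact: eq_bigl.
by move=> /seq.permP h; rewrite !E h.
Qed.

Lemma swap_off_scale s t mu nu : swap_off s t mu nu = s * swap_off 1 t mu nu.
Proof. by rewrite /swap_off; do 4?[case: ifP => _]; ring. Qed.

Lemma swap_off_perm s t mu nu : swap_off s t mu nu != 0 -> perm_eq (codom nu) (codom mu).
Proof.
rewrite /swap_off; do 4![case: ifP => [/existsP[a /existsP[b /and3P[_ _ /eqP ->]]] _|_];
  first exact: codom_swapw].
by rewrite eqxx.
Qed.

Lemma swap_off_ge0 s t mu nu : 0 <= s -> 0 <= t -> 0 <= swap_off s t mu nu.
Proof. by move=> s0 t0; rewrite /swap_off; do 4?[case: ifP => _]; rewrite ?mulr_ge0. Qed.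

Lemma swap_off_irr s t w : swap_off s t w w = 0.
Proof.
have F a b : (val (w a) < val (w b))%N -> w == swapw w a b = false.
  move=> lab; apply/negP => /eqP/ffunP/(_ a); rewrite ffunE eqxx => e.
  by rewrite e ltnn in lab.
have F' a b : (val (w b) < val (w a))%N -> w == swapw w a b = false.
  move=> lab; apply/negP => /eqP/ffunP/(_ a); rewrite ffunE eqxx => e.
  by rewrite e ltnn in lab.
rewrite /swap_off; do 4![case: ifP => [/existsP[a /existsP[b /and3P[_ l]]]|_];
  first by rewrite ?(F _ _ l) ?(F' _ _ l)].
by [].
Qed.

Lemma asep_offE t mu nu : asep_off t mu nu = n%:R^-1 * swap_off 1 t mu nu.
Proof.
rewrite /asep_off swap_off_scale; case: eqP => // ->.
by rewrite swap_off_irr mulr0.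
Qed.

Lemma dasep_offE t u mu nu :
  dasep_off t u mu nu = (3 * n%:R)^-1 * (swap_off 1 t mu nu + update_rate u mu nu).
Proof.
rewrite /dasep_off swap_off_scale /update_rate -/(raises mu nu).
have -> : [exists k, [&& (1 <= val (nu k))%N, val (mu k) == (val (nu k)).+1
                     & [forall j, (j != k) ==> (nu j == mu j)]]] = raises nu mu.
  by apply: eq_existsb => k; do 2!congr (_ && _); apply: eq_forallb => j;
    rewrite [nu j == _]eq_sym.
case: eqP => [->|_]; first by rewrite swap_off_irr !raises_irr !mulr0 !addr0 mulr0.
by case: raises; case: raises => /=; ring.
Qed.

Lemma asep_off_irr t w : asep_off t w w = 0.
Proof. by rewrite /asep_off eqxx. Qed.

Lemma dasep_off_irr t u w : dasep_off t u w w = 0.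
Proof. by rewrite /dasep_off eqxx. Qed.

Lemma dasep_off_ge0 t u mu nu : 0 <= t -> 0 < u -> 0 <= dasep_off t u mu nu.
Proof.
move=> t0 u0; rewrite dasep_offE mulr_ge0 ?invr_ge0 ?mulr_ge0 ?ler0n //.
by apply: addr_ge0; [apply: swap_off_ge0 | apply: update_rate_ge0].
Qed.

Lemma is_partition_rearr_exists w : exists2 lam, is_partition lam & w \in rearr lam.
Proof.
have geT : total (fun x y : 'I_m => (y <= x)%N) by move=> x y; apply: leq_total.
have geTr : transitive (fun x y : 'I_m => (y <= x)%N).
  by move=> y x z; move=> h1 h2; apply: leq_trans h2 h1.
pose s := sort (fun x y : 'I_m => (y <= x)%N) (codom w).
have szs : size s = n by rewrite size_sort size_codom card_ord.
pose lam : word n m := [ffun i => nth (w i) s i].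
exists lam.
  apply/forallP => i; apply/forallP => j; apply/implyP => lij; rewrite !ffunE.
  rewrite (set_nth_default (w i)) ?szs //.
  have := sorted_leq_nth geTr (fun x => leqnn x) (w i) (sort_sorted geT (codom w)).
  by apply; rewrite ?inE -/s ?szs.
rewrite inE; have -> : codom lam = s; last by rewrite perm_sym perm_sort.
case: n w @s szs @lam => [|n'] w s szs lam.
  by rewrite (size0nil szs); apply: size0nil; rewrite size_codom card_ord.
apply: (@eq_from_nth _ (w ord0)); rewrite size_codom card_ord ?szs // => i lti.
rewrite (nth_map ord0) ?size_enum_ord // ffunE nth_enum_ord //.
by apply: set_nth_default; rewrite szs.
Qed.

End Moves.

Section ThreeLetters.
Variables (R : realFieldType) (m : nat).
Implicit Types (a b c : 'I_m) (mu nu w : word 3 m).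

Local Notation o0 := (@Ordinal 3 0 isT).
Local Notation o1 := (@Ordinal 3 1 isT).
Local Notation o2 := (@Ordinal 3 2 isT).

Definition word3 a b c : word 3 m := [ffun i => tnth [tuple a; b; c] i].

Lemma exists_ord3 (P : pred 'I_3) : [exists i, P i] = [|| P o0, P o1 | P o2].
Proof.
apply/existsP/or3P => [[i]|[] Pi]; last 3 first.
- by exists o0.
- by exists o1.
- by exists o2.
by case: i => -[|[|[|//]]] lti Pi;
  [constructor 1|constructor 2|constructor 3]; rewrite (bool_irrelevance isT lti).
Qed.

Lemma forall_ord3 (P : pred 'I_3) : [forall i, P i] = [&& P o0, P o1 & P o2].
Proof. by rewrite -[LHS]negbK negb_forall exists_ord3 !negb_or !negbK. Qed.

Lemma codom3 w : codom w = [:: w o0; w o1; w o2].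
Proof.
rewrite /codom /image_mem; have -> : enum 'I_3 = [:: o0; o1; o2]; last by [].
by apply: (inj_map val_inj); rewrite val_enum_ord.
Qed.

Lemma codom_word3 a b c : codom (word3 a b c) = [:: a; b; c].
Proof. by rewrite codom3 !ffunE. Qed.

Lemma word3_eta w : w = word3 (w o0) (w o1) (w o2).
Proof.
apply/eqP; have : [forall i, w i == word3 (w o0) (w o1) (w o2) i].
  by rewrite forall_ord3 !ffunE !eqxx.
by move/forallP => h; apply/eqP/ffunP => i; apply/eqP.
Qed.

Lemma eq_word3 a b c a' b' c' :
  (word3 a b c == word3 a' b' c') = [&& a == a', b == b' & c == c'].
Proof.
apply/eqP/and3P => [E|[/eqP-> /eqP-> /eqP->]//].
by have := congr1 (fun w : word 3 m => codom w) E; rewrite !codom_word3 => -[-> -> ->].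
Qed.

Lemma nnz3 w : nnz w = ((val (w o0) != 0) + (val (w o1) != 0) + (val (w o2) != 0))%N.
Proof.
by rewrite /nnz -sum1_card big_mkcond /= !big_ord_recl big_ord0 /= !inE addn0 addnA; 
  congr (_ + _ + _)%N; congr (nat_of_bool (val (w _) != _)); apply: val_inj.
Qed.

Lemma swapw_word3 a b c :
  [/\ swapw (word3 a b c) o0 o1 = word3 b a c,
      swapw (word3 a b c) o1 o2 = word3 a c b &
      swapw (word3 a b c) o0 o2 = word3 c b a].
Proof. by split; rewrite [LHS]word3_eta !ffunE. Qed.

Lemma swap_off_word3 (s t : R) a b c nu :
  swap_off s t (word3 a b c) nu =
  if (b < a)%N && (nu == word3 b a c) || (c < b)%N && (nu == word3 a c b) then t * s
  else if (a < b)%N && (nu == word3 b a c) || (b < c)%N && (nu == word3 a c b) then s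
  else if (a < c)%N && (nu == word3 c b a) then t * s
  else if (c < a)%N && (nu == word3 c b a) then s else 0.
Proof.
have [e01 e12 e02] := swapw_word3 a b c.
rewrite /swap_off !exists_ord3 /adjpos /wrappos /= e01 e12 e02 !ffunE /=.
by rewrite !(orbF, orFb).
Qed.

(* On a ring of three sites every two positions are adjacent. *)
Lemma swap_off3_sym mu nu :
  swap_off (1 : R) 1 mu nu = [exists i, exists j, (mu i != mu j) && (nu == swapw mu i j)]%:R.
Proof.
rewrite [mu]word3_eta; move: (mu _) (mu _) (mu _) => c b a.
have [e01 e12 e02] := swapw_word3 a b c.
rewrite swap_off_word3 !exists_ord3 (swapwC _ o1 o0) (swapwC _ o2 o1) (swapwC _ o2 o0).
rewrite e01 e12 e02 !ffunE /= !eqxx /=.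
rewrite -!val_eqE /= !mulr1 !neq_ltn !ltnn /=.
by case: (nu == word3 b _ _); case: (nu == word3 a _ _); case: (nu == word3 c _ _);
  case: (ltngtP a b); case: (ltngtP b c); case: (ltngtP a c); rewrite ?orbT.
Qed.

Lemma swap_off3C mu nu : swap_off (1 : R) 1 mu nu = swap_off (1 : R) 1 nu mu.
Proof.
have sub x y : [exists i, exists j, ((x : word 3 m) i != x j) && (y == swapw x i j)] ->
    [exists i, exists j, (y i != y j) && (x == swapw y i j)].
  case/existsP => i /existsP[j /andP[xij /eqP ->]].
  apply/existsP; exists i; apply/existsP; exists j.
  by rewrite swapwK eqxx andbT swapw_tperm !ffunE tpermL tpermR eq_sym.
by rewrite !swap_off3_sym; congr (_%:R); congr nat_of_bool; apply/idP/idP; apply: sub.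
Qed.

Lemma swap_off3_neq0 mu i j : mu i != mu j -> swap_off (1 : R) 1 mu (swapw mu i j) != 0.
Proof.
move=> mij; rewrite swap_off3_sym.
have -> : [exists i', exists j', (mu i' != mu j') && (swapw mu i j == swapw mu i' j')].
  by apply/existsP; exists i; apply/existsP; exists j; rewrite mij eqxx.
by rewrite oner_eq0.
Qed.

Lemma swapw_invariant (A : Type) (F : word 3 m -> A) (S : pred (word 3 m)) :
  (forall w w', w \in S -> perm_eq (codom w') (codom w) -> w' \in S) ->
  (forall w w', w \in S -> w' \in S -> swap_off (1 : R) 1 w w' != 0 -> F w = F w') ->
  forall mu nu, mu \in S -> perm_eq (codom nu) (codom mu) -> F nu = F mu.
Proof.
move=> Sperm FE mu nu Smu; apply: perm_codom_invariant => w i j wmu.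
have Sw := Sperm _ _ Smu wmu.
have [wij|wij] := eqVneq (w i) (w j).
  congr F; apply/ffunP => k; rewrite ffunE.
  by case: eqVneq => [->//|_]; case: eqVneq => [->|].
by apply/esym/FE; rewrite ?swap_off3_neq0 // (Sperm w) // codom_swapw.
Qed.

End ThreeLetters.

Section SymmetricCase.
Variables (R : realFieldType) (m : nat).

Lemma stationary_asep_sym (lam : word 3 m) (pi : word 3 m -> R) :
  stationary (rearr lam) (asep_off 1) pi ->
  forall mu nu, mu \in rearr lam -> nu \in rearr lam -> pi mu / pi nu = 1.
Proof.
move=> st; have [_ _ sum1 _] := st.
have pi_const w w' : w \in rearr lam -> w' \in rearr lam ->
    swap_off (1 : R) 1 w w' != 0 -> pi w = pi w'.
  move=> lw lw' off_neq0; rewrite -[LHS]divr1 -[RHS]divr1.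
  apply: (@reversible_balance_eq R _ (rearr lam) (fun=> 1) (asep_off 1)) => //.
  - by move=> x y; rewrite asep_offE mulr_ge0 ?invr_ge0 ?ler0n ?swap_off_ge0.
  - by move=> x y _ _; rewrite !asep_offE swap_off3C.
  - by move=> y; apply: stationary_balance st (asep_off_irr 1).
  - by rewrite asep_offE mulf_neq0 // invr_eq0 pnatr_eq0.
have piE mu nu : mu \in rearr lam -> nu \in rearr lam -> pi mu = pi nu.
  move=> lmu lnu; apply: (@swapw_invariant R m _ pi (rearr lam)) => //.
    by move=> w w'; rewrite !inE => lw ww'; apply: perm_trans lw.
  by apply: perm_trans lmu _; rewrite perm_sym.
move=> mu nu lmu lnu; rewrite (piE mu nu) // divff //.
apply/eqP => nu0; move/esym/eqP: sum1; rewrite big1 ?oner_eq0 // => w lw.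
by rewrite (piE w nu).
Qed.

Lemma nnz_le1_perm (l0 l1 : 'I_m) (w : word 3 m) :
  val l0 = 0%N -> val l1 = 1%N -> nnz w = 2%N -> (forall k, (val (w k) < 2)%N) ->
  perm_eq (codom w) (codom (word3 l0 l1 l1)).
Proof.
move=> e0 e1 nnzw w_lt2.
have wE k : exists b : bool, w k = if b then l1 else l0.
  exists (val (w k) != 0%N); apply: val_inj.
  by have := w_lt2 k; case: (w k) => -[|[|//]] lt_ _ /=; rewrite ?e0 ?e1.
move: nnzw; rewrite nnz3 codom_word3 codom3.
have [b0 ->] := wE (Ordinal (isT : 0 < 3)%N); have [b1 ->] := wE (Ordinal (isT : 1 < 3)%N).
have [b2 ->] := wE (Ordinal (isT : 2 < 3)%N).
by case: b0; case: b1; case: b2; rewrite ?e0 ?e1 //= => _; apply/seq.permP => P /=; lia.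
Qed.

Lemma stationary_dasep_sym (u : R) (Pd : word 3 m -> R) :
  (1 < m)%N -> 0 < u ->
  stationary (dasep_states 3 m 2) (dasep_off 1 u) Pd ->
  forall mu nu : word 3 m, mu \in dasep_states 3 m 2 -> perm_eq (codom nu) (codom mu) ->
    Pd mu / Pd nu = 1.
Proof.
move=> m_gt1 u0 st; have [_ _ sum1 _] := st.
set S := dasep_states 3 m 2 in st sum1 *.
pose g w := Pd w / weight u w.
have wt_neq0 (w : word 3 m) : weight u w != 0 by rewrite lt0r_neq0 ?weight_gt0.
have Sperm (w w' : word 3 m) : w \in S -> perm_eq (codom w') (codom w) -> w' \in S.
  by rewrite !inE => Sw ww'; rewrite (nnz_perm ww').
have edge w w' : w \in S -> w' \in S -> dasep_off 1 u w w' != 0 -> g w = g w'.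
  apply: reversible_balance_eq => [x|x y|x y _ _|y Sy].
  - exact: weight_gt0.
  - exact: dasep_off_ge0.
  - rewrite !dasep_offE !(mulrCA (weight _ _)); congr (_ * _).
    rewrite [LHS]mulrDr [RHS]mulrDr update_rate_reversible swap_off3C; congr (_ + _).
    have [->|h] := eqVneq (swap_off (1 : R) 1 y x) 0; first by rewrite !mulr0.
    by rewrite (weight_perm u (swap_off_perm h)).
  - exact: stationary_balance st (dasep_off_irr 1 u) Sy.
have c_gt0 : (3 * 3%:R)^-1 > 0 :> R by rewrite invr_gt0 mulr_gt0 ?ltr0n.
have g_perm (w w' : word 3 m) : w \in S -> perm_eq (codom w') (codom w) -> g w' = g w.
  apply: (@swapw_invariant R m _ g S Sperm) => x y Sx Sy off.
  apply: edge; rewrite // dasep_offE mulf_neq0 ?lt0r_neq0 //.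
  by rewrite ltr_pwDl ?update_rate_ge0 // lt0r off swap_off_ge0.
pose l0 : 'I_m := Ordinal (ltnW m_gt1); pose l1 : 'I_m := Ordinal m_gt1.
pose w1 := word3 l0 l1 l1.
have Sw1 : w1 \in S by rewrite inE nnz3 !ffunE.
have g_const w : w \in S -> g w = g w1.
  have [k] := ubnP (\sum_i val (w i))%N; elim: k w => // k IH w lt_k Sw.
  have [/existsP[i /= wi]|] := boolP [exists i, (2 <= val (w i))%N]; last first.
    rewrite negb_exists => /forallP w_lt2; apply: g_perm => //.
    by apply: nnz_le1_perm => //; [exact/eqP|move=> i; rewrite ltnNge].
  have lt_pred : ((val (w i)).-1 < m)%N by apply: leq_ltn_trans (leq_pred _) (ltn_ord _).
  pose w' : word 3 m := [ffun j => if j == i then Ordinal lt_pred else w j].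
  have up : raises w' w.
    apply/existsP; exists i; rewrite !ffunE eqxx /=; apply/and3P; split; try lia.
    by apply/forallP => j; apply/implyP => /negPf ji; rewrite ffunE ji.
  have Sw' : w' \in S.
    rewrite inE; apply/eqP; rewrite -[RHS](eqP Sw); apply: eq_card => j; rewrite !inE !ffunE.
    by case: (j =P i) => // -> /=; lia.
  rewrite -(IH w') //; last first.
    move: lt_k; rewrite (bigD1 i) //= [X in _ -> (X < _)%N](bigD1 i) //= ffunE eqxx /=.
    have -> : (\sum_(j | j != i) w' j = \sum_(j | j != i) w j)%N.
      by apply: eq_bigr => j /negPf ji; rewrite ffunE ji.
    by move: wi => /=; lia.
  apply/esym/edge; rewrite // dasep_offE mulf_neq0 ?lt0r_neq0 //.
  by rewrite ltr_wpDl ?swap_off_ge0 // lt0r update_rate_neq0 ?update_rate_ge0.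
move=> mu nu Smu pnm.
have Pd_eq : Pd nu = Pd mu.
  have := g_perm _ _ Smu pnm; rewrite /g (weight_perm u pnm).
  by move/divIf; apply.
rewrite Pd_eq divff //; apply/eqP => mu0.
move/esym/eqP: sum1; rewrite big1 ?oner_eq0 // => w Sw.
have : g w = g mu by rewrite !g_const.
by rewrite /g mu0 mul0r => /eqP; rewrite mulf_eq0 invr_eq0 (negPf (wt_neq0 w)) orbF => /eqP.
Qed.

End SymmetricCase.

Lemma proportional_update_balance (R : realFieldType) (n m q : nat) (t u : R)
    (Pr : word n m -> word n m -> R) (Pd : word n m -> R) :
  (0 < n)%N ->
  (forall lam, is_partition lam -> nnz lam = q ->
     stationary (rearr lam) (asep_off t) (Pr lam)) ->
  stationary (dasep_states n m q) (dasep_off t u) Pd ->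
  (forall lam, is_partition lam -> nnz lam = q ->
     forall mu nu, mu \in rearr lam -> nu \in rearr lam ->
       Pr lam mu / Pr lam nu = Pd mu / Pd nu) ->
  forall nu, nu \in dasep_states n m q ->
    \sum_(mu in dasep_states n m q)
      (Pd mu * update_rate u mu nu - Pd nu * update_rate u nu mu) = 0.
Proof.
move=> n_gt0 stPr stPd ratio nu Snu; set S := dasep_states n m q in Snu stPd *.
have n_neq0 : n%:R != 0 :> R by rewrite pnatr_eq0 -lt0n.
have [lam part lnu] := is_partition_rearr_exists nu.
have nnz_lam : nnz lam = q by rewrite -(nnz_perm lnu); apply/eqP.
have st := stPr lam part nnz_lam; have [_ _ sum1 _] := st.
have [c Pd_prop] : exists c, forall mu, mu \in rearr lam -> Pd mu = c * Pr lam mu.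
  have [/existsP[k /andP[lk Pk]]|] := boolP [exists k, (k \in rearr lam) && (Pr lam k != 0)].
    have Pdk : Pd k != 0.
      apply/eqP => Pdk; have := ratio lam part nnz_lam k k lk lk.
      by rewrite Pdk mul0r divff // => /eqP; rewrite oner_eq0.
    exists (Pd k / Pr lam k) => mu lmu; have := ratio lam part nnz_lam mu k lmu lk.
    by move/(congr1 (fun x => x * Pd k)); rewrite divfK // => <-; ring.
  rewrite negb_exists => /forallP P0; move/esym/eqP: sum1; rewrite big1 ?oner_eq0 //.
  by move=> w lw; have := P0 w; rewrite lw negbK => /eqP.
have swap_bal : \sum_(mu in S) (Pd mu * swap_off 1 t mu nu - Pd nu * swap_off 1 t nu mu) = 0.
  have := stationary_balance st (asep_off_irr t) lnu.
  move/(congr1 (fun x => n%:R * c * x)); rewrite mulr0 => h.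
  rewrite -[RHS]h mulr_sumr {h} [LHS](bigID (mem (rearr lam))) /= [X in _ + X]big1 ?addr0.
    apply: eq_big => mu.
      rewrite andbC; apply: andb_idr => lmu; rewrite !inE -nnz_lam.
      by rewrite (nnz_perm lmu).
    by case/andP => _ lmu; rewrite !Pd_prop // !asep_offE; field.
  move=> mu /andP[_ lmu].
  have [->|h] := eqVneq (swap_off (1 : R) t mu nu) 0; last first.
    case/negP: lmu; rewrite !inE.
    by have := swap_off_perm h; rewrite perm_sym => /perm_trans; apply.
  have [->|h] := eqVneq (swap_off (1 : R) t nu mu) 0; last first.
    by case/negP: lmu; rewrite !inE; apply: perm_trans (swap_off_perm h) _.
  by rewrite !mulr0 subrr.
have := stationary_balance stPd (dasep_off_irr t u) Snu.
move/(congr1 (fun x => 3 * n%:R * x)); rewrite mulr0 => h.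
rewrite -[RHS](subr0 0) -[in X in X - _]h -[in X in _ - X]swap_bal mulr_sumr -sumrB.
by apply: eq_bigr => mu _; rewrite !dasep_offE; field.
Qed.

Definition perms3 (m : nat) (l0 l1 l2 : 'I_m) : seq (word 3 m) :=
  [:: word3 l0 l1 l2; word3 l1 l2 l0; word3 l2 l0 l1;
      word3 l0 l2 l1; word3 l1 l0 l2; word3 l2 l1 l0].

Lemma rearr_perms3 (m : nat) (l0 l1 l2 : 'I_m) :
  uniq [:: l2; l1; l0] -> rearr (word3 l2 l1 l0) =i perms3 l0 l1 l2.
Proof.
move=> ul w; rewrite [w]word3_eta; move: (w _) (w _) (w _) => c b a.
rewrite [LHS]inE !codom_word3 !inE !eq_word3; apply/idP/idP => [pe|].
  have mem x : x \in [:: a; b; c] -> x \in [:: l2; l1; l0] by rewrite (perm_mem pe).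
  have ma := mem a (mem_head _ _); have mb := mem b; have mc := mem c.
  move: (perm_uniq pe) ma mb mc; rewrite ul /= !inE !eqxx !orbT /=.
  by move=> uabc /or3P[] /eqP ea /(_ isT) /or3P[] /eqP eb /(_ isT) /or3P[] /eqP ec;
    move: uabc; rewrite ea eb ec !eqxx ?orbT //= ?andbF ?orbT.
by do 5?[case/orP]; case/and3P=> /eqP-> /eqP-> /eqP->; apply/seq.permP => P /=; lia.
Qed.

Lemma sum_rearr3 (R : realFieldType) (m : nat) (l0 l1 l2 : 'I_m) (F : word 3 m -> R) :
  uniq [:: l2; l1; l0] ->
  \sum_(w in rearr (word3 l2 l1 l0)) F w =
  F (word3 l0 l1 l2) + F (word3 l1 l2 l0) + F (word3 l2 l0 l1) +
  (F (word3 l0 l2 l1) + F (word3 l1 l0 l2) + F (word3 l2 l1 l0)).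
Proof.
move=> ul; rewrite (eq_bigl _ _ (rearr_perms3 ul)) -big_uniq.
  by rewrite !big_cons big_nil /=; ring.
move: ul; rewrite /= !inE !eq_word3 !negb_or !(eq_sym l0) !(eq_sym l1 l2).
by case/and3P => /andP[/negPf-> /negPf->] /negPf-> _; rewrite /= ?andbF.
Qed.

(* Each word in the cyclic order l0 l1 l2 leaves that order at rate 2 + t, each word in the
   order l0 l2 l1 at rate 1 + 2 t: the sum of the balance equations equates the two flows. *)
Lemma asep3_cyclic_flow (R : realFieldType) (m : nat) (l0 l1 l2 : 'I_m) (t : R)
    (P : word 3 m -> R) :
  (l0 < l1)%N -> (l1 < l2)%N -> stationary (rearr (word3 l2 l1 l0)) (asep_off t) P ->
  (2 + t) * (P (word3 l0 l1 l2) + P (word3 l1 l2 l0) + P (word3 l2 l0 l1)) =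
  (1 + 2 * t) * (P (word3 l0 l2 l1) + P (word3 l1 l0 l2) + P (word3 l2 l1 l0)).
Proof.
move=> lt01 lt12 st; have lt02 := ltn_trans lt01 lt12.
have e01 : (l0 == l1) = false by rewrite -val_eqE ltn_eqF.
have e02 : (l0 == l2) = false by rewrite -val_eqE ltn_eqF.
have e12 : (l1 == l2) = false by rewrite -val_eqE ltn_eqF.
have e10 : (l1 == l0) = false by rewrite eq_sym.
have e20 : (l2 == l0) = false by rewrite eq_sym.
have e21 : (l2 == l1) = false by rewrite eq_sym.
have g01 : (l1 < l0)%N = false by rewrite ltnNge ltnW.
have g02 : (l2 < l0)%N = false by rewrite ltnNge ltnW.
have g12 : (l2 < l1)%N = false by rewrite ltnNge ltnW.
have ul : uniq [:: l2; l1; l0] by rewrite /= !inE e21 e20 e10.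
have bal nu : nu \in rearr (word3 l2 l1 l0) ->
    \sum_(mu in rearr (word3 l2 l1 l0)) (P mu * swap_off 1 t mu nu - P nu * swap_off 1 t nu mu) = 0.
  move/(stationary_balance st (asep_off_irr t))/(congr1 (fun x => 3 * x)).
  rewrite mulr0 => h; rewrite -[RHS]h mulr_sumr; apply: eq_bigr => mu _.
  by rewrite !asep_offE; field.
have rates := (e01, e02, e12, e10, e20, e21, g01, g02, g12, lt01, lt02, lt12, eqxx).
have := bal (word3 l0 l1 l2).
rewrite rearr_perms3 // !inE eqxx /= => /(_ isT).
rewrite !sum_rearr3 // !swap_off_word3 !eq_word3 !rates /= => h1.
have := bal (word3 l1 l2 l0).
rewrite rearr_perms3 // !inE eqxx orbT /= => /(_ isT).
rewrite !sum_rearr3 // !swap_off_word3 !eq_word3 !rates /= => h2.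
have := bal (word3 l2 l0 l1).
rewrite rearr_perms3 // !inE eqxx !orbT /= => /(_ isT).
rewrite !sum_rearr3 // !swap_off_word3 !eq_word3 !rates /= => h3.
clear -h1 h2 h3.
lra.
Qed.

Unset Implicit Arguments.

Theorem mainTheorem6 (R : realFieldType) (p : nat) (t u : R)
  (Pr : word 3 p.+1 -> word 3 p.+1 -> R) (Pd : word 3 p.+1 -> R) :
  (2 <= p)%N -> 0 <= t -> t <= 1 -> 0 < u ->
  (forall lam : word 3 p.+1, is_partition lam -> nnz lam = 2%N ->
     stationary (rearr lam) (asep_off t) (Pr lam)) ->
  stationary (dasep_states 3 p.+1 2) (dasep_off t u) Pd ->
  (t = 1 <->
   forall lam : word 3 p.+1, is_partition lam -> nnz lam = 2%N ->
     forall mu nu, mu \in rearr lam -> nu \in rearr lam ->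
       Pr lam mu / Pr lam nu = Pd mu / Pd nu).
Proof.
move=> p_ge2 t_ge0 t_le1 u_gt0 stPr stPd; split.
  move=> t1 lam part nnz_lam mu nu lmu lnu; subst t.
  rewrite (stationary_asep_sym (stPr _ part nnz_lam)) //.
  rewrite (stationary_dasep_sym _ _ stPd) //; first exact: ltnW.
    by rewrite inE (nnz_perm lmu) nnz_lam.
  by apply: perm_trans lnu _; rewrite perm_sym.
move=> ratio.
case: p p_ge2 Pr Pd stPr stPd ratio => [//|[//|p]] _ Pr Pd stPr stPd ratio.
have bal := proportional_update_balance (isT : (0 < 3)%N) stPr stPd ratio.
pose l0 : 'I_p.+3 := @Ordinal p.+3 0 isT.
pose l1 : 'I_p.+3 := @Ordinal p.+3 1 isT.
pose l2 : 'I_p.+3 := @Ordinal p.+3 2 isT.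
pose w := @word3 p.+3.
have edge mu nu : nnz mu = 2%N -> nnz nu = 2%N -> raises mu nu ->
    Pd mu / weight u mu = Pd nu / weight u nu.
  move=> Smu Snu up.
  apply: (reversible_balance_eq (off := update_rate u) _ _ _ bal);
    rewrite ?inE ?Smu ?Snu ?update_rate_neq0 // => *.
  - exact: weight_gt0.
  - exact: update_rate_ge0.
  - exact: update_rate_reversible.
have swap12 (mu nu nu' : word 3 p.+3) : nnz mu = 2%N -> nnz nu = 2%N -> raises mu nu ->
    raises mu nu' -> perm_eq (codom nu') (codom nu) -> Pd nu = Pd nu'.
  move=> Smu Snu up up' pnn; have := edge mu nu' Smu _ up'.
  rewrite (nnz_perm pnn) => /(_ Snu); rewrite (edge mu nu) // (weight_perm u pnn).
  by move/divIf; apply; rewrite lt0r_neq0 ?weight_gt0.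
have E0 : Pd (w l0 l1 l2) = Pd (w l0 l2 l1).
  by apply: (swap12 (w l0 l1 l1));
    rewrite ?nnz3 ?codom_word3 /raises ?exists_ord3 ?forall_ord3 ?ffunE.
have E1 : Pd (w l2 l0 l1) = Pd (w l1 l0 l2).
  by apply: (swap12 (w l1 l0 l1));
    rewrite ?nnz3 ?codom_word3 /raises ?exists_ord3 ?forall_ord3 ?ffunE.
have E2 : Pd (w l1 l2 l0) = Pd (w l2 l1 l0).
  by apply: (swap12 (w l1 l1 l0));
    rewrite ?nnz3 ?codom_word3 /raises ?exists_ord3 ?forall_ord3 ?ffunE.
pose lam := w l2 l1 l0.
have part : is_partition lam.
  by rewrite /is_partition forall_ord3 !forall_ord3 !ffunE.
have nnz_lam : nnz lam = 2%N by rewrite nnz3 !ffunE.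
have PrE mu nu : mu \in rearr lam -> nu \in rearr lam -> Pd mu = Pd nu ->
    Pr lam mu = Pr lam nu.
  move=> lmu lnu e; have rt := ratio lam part nnz_lam.
  have [Pd0|Pd_neq0] := eqVneq (Pd nu) 0.
    have Pr0 x : x \in rearr lam -> Pd x = 0 -> Pr lam x = 0.
      move=> lx Pdx; have := rt x x lx lx; rewrite Pdx mul0r => /eqP.
      by rewrite mulf_eq0 invr_eq0 orbb => /eqP.
    by rewrite !Pr0 // e.
  have := rt mu nu lmu lnu; rewrite e divff // => h.
  have [P0|P_neq0] := eqVneq (Pr lam nu) 0.
    by move: h; rewrite P0 invr0 mulr0 => /eqP; rewrite eq_sym oner_eq0.
  by rewrite -[LHS](divfK P_neq0) h mul1r.
have ul : uniq [:: l2; l1; l0] by [].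
have {}E0 : Pr lam (w l0 l1 l2) = Pr lam (w l0 l2 l1).
  by apply: PrE E0; rewrite rearr_perms3 // !inE eqxx ?orbT.
have {}E1 : Pr lam (w l2 l0 l1) = Pr lam (w l1 l0 l2).
  by apply: PrE E1; rewrite rearr_perms3 // !inE eqxx ?orbT.
have {}E2 : Pr lam (w l1 l2 l0) = Pr lam (w l2 l1 l0).
  by apply: PrE E2; rewrite rearr_perms3 // !inE eqxx ?orbT.
have st := stPr lam part nnz_lam; have [_ _ sum1 _] := st.
have := asep3_cyclic_flow (isT : (l0 < l1)%N) (isT : (l1 < l2)%N) st.
move: sum1; rewrite sum_rearr3 // -/w E0 E1 E2.
move: (Pr lam _) (Pr lam _) (Pr lam _) => x y z sum1 flow.
have half : x + y + z = 2^-1 by lra.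
have /eqP : (t - 1) * (x + y + z) = 0 by lra.
by rewrite half mulf_eq0 invr_eq0 pnatr_eq0 orbF subr_eq0 => /eqP.
Qed.
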